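(* Let $X$ be a set of alternatives with $|X| = m = 2$ and let $N=\{1,\dots,n\}$ with $n\ge 2$. Let $G: L(X)^N \to 2^X\setminus\{\varnothing\}$ be a social choice correspondence satisfying both of: (1) the Pareto condition; and (2) tops-in. Then $G = G_P$, the Pareto correspondence.
   Context: $X$ is a finite set of alternatives with $|X|=m$, and $N=\{1,\dots,n\}$ is the set of individuals. $L(X)$ is the set of all (strong) orderings on $X$, i.e. complete, asymmetric, transitive relations (strict linear orders; no non-trivial indifference). For an ordering $r$, $r[1]$ denotes its top-ranked element. A profile is an element $u=(u(1),\dots,u(n))$ of $L(X)^N$; write $x\succ_i^u y$ if $x$ ranks above $y$ in $u(i)$. A social choice correspondence is a map $G$ from $L(X)^N$ to the non-empty subsets of $X$. At profile $u$, $x$ Pareto dominates $y$ if $x\succ_i^u y$ for all $i\in N$. The Pareto correspondence is $G_P(u)=\{x\in X: \text{no } y\in X \text{ Pareto dominates } x \text{ at } u\}$. Pareto condition: for all $x,y\in X$ and all profiles $u$, if $x$ Pareto dominates $y$ at $u$ then $y\notin G(u)$. Tops-in: $T(u)\subseteq G(u)$ for all profiles $u$, where $T(u)=\{x\in X: x=u(i)[1] \text{ for some } i\in N\}$. *)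

(* Defs.v *)
From mathcomp Require Import all_boot.
Set Implicit Arguments.
Unset Strict Implicit.
Unset Printing Implicit Defensive.

Section SocialChoice.

Variable X : finType.

(* Relations on X are represented by their graphs, so that orderings and
   profiles are finite types with extensional equality; (x, y) \in r reads
   "x ranks above y in r".  Since the relation is asymmetric, completeness
   only concerns distinct alternatives. *)
Definition complete_rel (r : {set X * X}) : bool :=
  [forall x, forall y, (x != y) ==> ((x, y) \in r) || ((y, x) \in r)].

Definition asymmetric_rel (r : {set X * X}) : bool :=
  [forall x, forall y, ((x, y) \in r) ==> ((y, x) \notin r)].

Definition transitive_rel (r : {set X * X}) : bool :=
  [forall x, forall y, forall z,
     ((x, y) \in r) && ((y, z) \in r) ==> ((x, z) \in r)].

Definition is_ordering (r : {set X * X}) : bool :=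
  [&& complete_rel r, asymmetric_rel r & transitive_rel r].

Definition ordering : Type := {r : {set X * X} | is_ordering r}.

Definition above (r : ordering) (x y : X) : bool := (x, y) \in val r.

(* The graph of r |-> r[1]; an ordering has at most one top element. *)
Definition is_top (r : ordering) (x : X) : bool :=
  [forall y, (y != x) ==> above r x y].

Variable n : nat.

Definition profile : Type := {ffun 'I_n -> ordering}.

Definition pareto_dominates (u : profile) (x y : X) : bool :=
  [forall i, above (u i) x y].

Record scc : Type := Scc {
  scc_fun :> profile -> {set X};
  scc_nonempty : forall u : profile, scc_fun u != set0
}.

Definition pareto_correspondence (u : profile) : {set X} :=
  [set x | ~~ [exists y, pareto_dominates u y x]].

Definition tops (u : profile) : {set X} :=
  [set x | [exists i, is_top (u i) x]].

Definition pareto_condition (G : profile -> {set X}) : Prop :=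
  forall (x y : X) (u : profile), pareto_dominates u x y -> y \notin G u.

Definition tops_in (G : profile -> {set X}) : Prop :=
  forall u : profile, tops u \subset G u.

End SocialChoice.

(* Main.v *)
Require Import Defs.
From mathcomp Require Import all_boot.

(** With two alternatives, ranking above the other alternative is the same as
    being top-ranked.  Hence an alternative that the other one does not Pareto
    dominate is somebody's top, by completeness of that individual's ordering:
    the Pareto correspondence is contained in the set of tops
    ([pareto_sub_tops]).  Tops-in therefore bounds [G] from below by the Pareto
    correspondence, and the Pareto condition bounds it from above
    ([sub_pareto]). *)

Lemma above_total (X : finType) (r : ordering X) (x y : X) :
  x != y -> above r x y || above r y x.
Proof.
by case/and3P: (valP r) => /forallP/(_ x)/forallP/(_ y)/implyP.
Qed.

Lemma sub_pareto (X : finType) (n : nat) (G : profile X n -> {set X}) :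
  pareto_condition G -> forall u, G u \subset pareto_correspondence u.
Proof.
move=> hP u; apply/subsetP => x Gx; rewrite inE.
by apply/existsP => -[y /hP]; rewrite Gx.
Qed.

Lemma pareto_sub_tops (X : finType) (n : nat) (u : profile X n) :
  #|X| = 2 -> pareto_correspondence u \subset tops u.
Proof.
move=> hX; apply/subsetP => x; rewrite !inE negb_exists => /forallP undom.
have /cards1P[y others] : #|[set~ x]| == 1 by rewrite cardsC1 hX.
have neqE z : (z != x) = (z == y).
  by have := in_setC1 z x; rewrite others inE.
have /forallPn[i nyx] := undom y.
apply/existsP; exists i; apply/forallP => z; apply/implyP.
rewrite neqE => /eqP->.
have yx : y != x by rewrite neqE.
by have := above_total _ (u i) y x yx; rewrite (negbTE nyx).
Qed.

Theorem theorem1 (X : finType) (n : nat) (G : scc X n)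
    (hX : #|X| = 2) (hn : 2 <= n)
    (hP : pareto_condition G) (hT : tops_in G) :
  forall u : profile X n, G u = pareto_correspondence u.
Proof.
move=> u; apply/eqP; rewrite eqEsubset sub_pareto //=.
exact: subset_trans (pareto_sub_tops _ _ u hX) (hT u).
Qed.
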